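(* For every fixed integer $d \geq 2$, \[f_d(n)=\frac{d-1}{d}\,n-\Theta\bigl(n^{\frac{d-1}{d}}\bigr)\qquad (n\to\infty),\] that is, there exist constants $c_1,c_2>0$ and $n_0$ (depending only on $d$) such that for all integers $n\ge n_0$, \[c_1\, n^{\frac{d-1}{d}}\le \frac{d-1}{d}\,n-f_d(n)\le c_2\, n^{\frac{d-1}{d}}.\]
   Context: Consider the regular tessellation of $\mathbb{R}^d$ by closed unit cubes (tiles), i.e. the integer translates of one axis-parallel closed unit cube. A $d$-polyomino is a finite union of tiles of this tessellation which has connected interior (equivalently, any two of its tiles are joined by a sequence of its tiles in which consecutive tiles share a $(d-1)$-dimensional face). An $n$-omino is a polyomino with $n$ tiles. A hole in a $d$-polyomino is a bounded connected component of its complement in $\mathbb{R}^d$. For fixed $d$ and a positive integer $n$, $f_d(n)$ denotes the maximum number of holes in a $d$-dimensional $n$-omino. *)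

(* Defs.v *)
From HB Require Import structures.
From mathcomp Require Import all_boot all_order all_algebra.
From mathcomp Require Import all_classical all_reals all_analysis.
Set Implicit Arguments.
Unset Strict Implicit.
Unset Printing Implicit Defensive.
Import Order.TTheory GRing.Theory Num.Theory.
Import numFieldNormedType.Exports.
Local Open Scope classical_set_scope.
Local Open Scope card_scope.
Local Open Scope ring_scope.

(* R^d is 'rV[R]_d; its norm is the sup norm, which induces the usual topology
   and the usual bounded sets. *)

Definition tile (R : realType) (d : nat) (z : 'rV[int]_d) : set 'rV[R]_d :=
  [set x | forall i : 'I_d,
     (z ord0 i)%:~R <= x ord0 i <= (z ord0 i)%:~R + 1].

Definition omino (R : realType) (d n : nat) (P : set 'rV[R]_d) : Prop :=
  exists S : set 'rV[int]_d,
    [/\ S #= `I_n, P = \bigcup_(z in S) @tile R d z & connected P°].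

Definition holes (R : realType) (d : nat) (P : set 'rV[R]_d) :
    set (set 'rV[R]_d) :=
  [set H | bounded_set H /\
           exists2 x, (~` P) x & H = connected_component (~` P) x].

Definition is_max_holes (R : realType) (d n m : nat) : Prop :=
  (exists2 P : set 'rV[R]_d, omino n P & holes P #= `I_m) /\
  (forall P : set 'rV[R]_d, omino n P -> holes P #<= `I_m).

(* At most one m satisfies is_max_holes R d n m; xget selects it.  The value 0
   is a default that is used only if no maximum exists. *)
Definition max_holes (R : realType) (d n : nat) : nat :=
  xget 0%N [set m | is_max_holes R d n m].

(* Main.v *)
Require Import Defs.
From HB Require Import structures.
From mathcomp Require Import all_boot all_order all_algebra.
From mathcomp Require Import all_classical all_reals all_analysis.
From mathcomp Require Import algC finmap zify ring lra.
Set Implicit Arguments.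
Unset Strict Implicit.
Unset Printing Implicit Defensive.
Import Order.TTheory GRing.Theory Num.Theory.
Import numFieldNormedType.Exports.
Local Open Scope ring_scope.

(** Write a polyomino P as the union of the tiles of a finite set S of n cells
    of Z^d, and let h be its number of holes.

    Upper bound on h. Fix a coordinate direction i and look at the tiles z of S
    according to the next cell z + e_i. Three kinds of tiles are pairwise
    disjoint: those with z + e_i in S; those with z + e_i in a hole; and those
    after which the whole ray in direction i avoids S. Every hole is entered
    from below in direction i, so there are at least h tiles of the second kind;
    every line in direction i that meets S has a last tile, so the third kind
    has at least as many tiles as the shadow of S along i ([direction_count]).
    Connectedness of the interior makes the adjacency graph of S connected, so
    over all d directions the first kind occurs at least n - 1 times
    ([card_forward_ge]). Summing over i gives
      n + p + d h <= d n + 1,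
    where p is the sum of the d shadow sizes ([holes_count]). A weak form of the
    Loomis-Whitney inequality, n^(d-1) <= p^d ([card_le_sum_shadows]), makes
    p at least n^((d-1)/d), and this is the required loss.

    Lower bound on h. Equality above up to boundary terms asks for holes that
    are single cells and for a tree-like S. Weight the coordinates by the odd
    numbers 1, 3, ..., 2d-1, put phase(x) = sum_j (2j+1) x_j modulo
    2 (2d-1), and remove the cells of even nonzero phase. Neighbours have phases
    of opposite parity, so removed cells are isolated. The phases 0 and 2d-1
    form full lines in the last direction (its weight is 2d-1), and every
    remaining odd phase is within one step of phase 0, because the residues
    +-(2j+1) exhaust the odd residues modulo 2 (2d-1). Hence the tiles form
    disjoint combs, which are joined to each other by keeping the boundary of a
    large box intact ([sponge_origin]). If the side M of the interior of the box
    is a multiple of 2 (2d-1), exactly M^d (d-1)/(2d-1) cells are removed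
    ([card_pits]), so the number of holes is (d-1)/d times the number of tiles
    up to O(M^(d-1)). A straight tail attached to the box realizes every number
    of tiles between two consecutive boxes ([max_holes_ge]).

    Both halves use a dictionary between R^d and Z^d: connected components of
    the complement of P contain tile centres, two centres of face-adjacent
    missing cells lie in the same component, a missing ray makes its component
    unbounded, and a missing cell all of whose neighbours are present is a
    component by itself. *)

(** * Tiles, segments and connected components *)

Section Geometry.
Context {R : realType} {d : nat}.
Implicit Types (z w : 'rV[int]_d) (x y : 'rV[R]_d) (A : set 'rV[R]_d).
Implicit Types (S : set 'rV[int]_d).

Definition cells S : set 'rV[R]_d := (\bigcup_(z in S) @tile R d z)%classic.

Definition tile_center z : 'rV[R]_d := \row_i ((z ord0 i)%:~R + 2^-1).

Definition open_tile z : set 'rV[R]_d :=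
  [set x | forall i : 'I_d,
     (z ord0 i)%:~R < x ord0 i < (z ord0 i)%:~R + 1]%classic.

Lemma intr_ltD1 (a b : int) : (a%:~R < b%:~R + 1 :> R) -> (a <= b)%R.
Proof. by rewrite -[1]/(1%:~R) -intrD ltr_int ltzD1. Qed.

Lemma open_tileW z : (open_tile z `<=` tile z)%classic.
Proof. by move=> x zx i; have /andP[/ltW -> /ltW ->] := zx i. Qed.

Lemma open_tile_tile_center z : open_tile z (tile_center z).
Proof. by move=> i; rewrite mxE; apply/andP; split; lra. Qed.

Lemma open_tile_eq z w x : open_tile z x -> tile w x -> w = z.
Proof.
move=> zx wx; apply/rowP => i; apply: le_anti; apply/andP; split;
  apply: intr_ltD1; have /andP[zx1 zx2] := zx i;
  by have /andP[wx1 wx2] := wx i; lra.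
Qed.

Lemma tile_tile_center z w : tile w (tile_center z) -> w = z.
Proof. exact/open_tile_eq/open_tile_tile_center. Qed.

Lemma cells_center S z : cells S (tile_center z) <-> S z.
Proof.
split=> [[w Sw /tile_tile_center <-//]|Sz].
by exists z => //; apply/open_tileW/open_tile_tile_center.
Qed.

(** Segments are the only connected sets needed: every path in the sequel is a
    chain of segments that join a point of a tile to its centre, or the centres
    of two adjacent tiles. *)
Lemma segment_component A x y :
  (forall t, 0 <= t <= 1 -> A (x + t *: (y - x))) ->
  connected_component A x y.
Proof.
move=> seg; pose f t : 'rV[R]_d := x + t *: (y - x).
exists (f @` `[0, 1])%classic; last first.
  by exists 1; rewrite /= ?in_itv /= ?lexx ?ler01 // /f scale1r addrC subrK.
split.
- by exists 0; rewrite /= ?in_itv /= ?lexx ?ler01 // /f scale0r addr0.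
- by move=> _ [t /= t01 <-]; apply: seg; rewrite in_itv in t01.
- apply: connected_continuous_connected; first exact: segment_connected.
  apply: continuous_subspaceT => t.
  by apply: cvgD; [exact: cvg_cst|apply: cvgZr_tmp; exact: cvg_id].
Qed.

Lemma tile_segment z x t : tile z x -> 0 < t <= 1 ->
  open_tile z (x + t *: (tile_center z - x)).
Proof.
move=> zx /andP[t0 t1] i; rewrite !mxE; have /andP[h1 h2] := zx i.
by apply/andP; split; nra.
Qed.

(** A tile is star-shaped about its centre, and the segment from a point of it
    to the centre is inside the open tile except possibly at that point. So
    only the point itself and the open tile need to lie in [A]. This is used
    both for the complement and for the interior of a polyomino. *)
Lemma to_center_component A z x : A x -> (open_tile z `<=` A)%classic ->
  tile z x -> connected_component A x (tile_center z).
Proof.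
move=> Ax zA zx; apply: segment_component => t /andP[t0 t1].
have [->|tn0] := eqVneq t 0; first by rewrite scale0r addr0.
by apply/zA/tile_segment => //; rewrite t1 lt0r tn0 t0.
Qed.

Lemma open_tile_cells S z : S z -> (open_tile z `<=` cells S)%classic.
Proof. by move=> Sz x /open_tileW; exists z. Qed.

Lemma open_tile_cellsC S z : ~ S z -> (open_tile z `<=` ~` cells S)%classic.
Proof. by move=> nSz x zx [w Sw /(open_tile_eq zx) wz]; rewrite -wz in nSz. Qed.

Lemma nbhs_rV A x (e : R) : 0 < e ->
  (forall y, (forall i, `|x ord0 i - y ord0 i| < e) -> A y) -> nbhs x A.
Proof.
move=> e0 xA; apply/nbhs_ballP; exists e => //= y [_ xy]; apply: xA => i.
exact: (xy ord0 i).
Qed.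

Lemma nbhs_rVP A x : nbhs x A -> exists2 e : R, 0 < e &
  (forall y, (forall i, `|x ord0 i - y ord0 i| < e) -> A y).
Proof.
move=> /nbhs_ballP [e /= e0 xA]; exists e => // y xy; apply: xA; split=> // i j.
rewrite (ord1 i); exact: xy.
Qed.

Lemma nbhs_open_tile z x : open_tile z x -> nbhs x (open_tile z).
Proof.
move=> zx; apply: (@filter_forall _ _ (fun i (y : 'rV[R]_d) =>
  (z ord0 i)%:~R < y ord0 i < (z ord0 i)%:~R + 1)%classic (nbhs x) _ _) => i.
have nx : nbhs (x ord0 i)
    [set u | (z ord0 i)%:~R < u < (z ord0 i)%:~R + 1]%classic.
  have : x ord0 i \in `]((z ord0 i)%:~R : R), (z ord0 i)%:~R + 1[.
    by rewrite in_itv /= zx.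
  by move=> /near_in_itvoo; apply: filterS => u /=; rewrite in_itv.
exact: (@coord_continuous R 1 d ord0 i x _ nx).
Qed.

Lemma open_tile_interior S z : S z -> (open_tile z `<=` (cells S)°)%classic.
Proof.
move=> Sz x zx; exact: (filterS (open_tile_cells Sz) (nbhs_open_tile zx)).
Qed.

Lemma closed_tile z : closed (@tile R d z).
Proof.
rewrite [tile z](_ : _ = \bigcap_(i in [set: 'I_d])
  ((fun x : 'rV[R]_d => x ord0 i) @^-1`
     `[((z ord0 i)%:~R : R), (z ord0 i)%:~R + 1]))%classic.
  apply: closed_bigI => i _; apply: closed_comp => [x _|].
    exact: coord_continuous.
  exact: interval_closed.
apply/seteqP; split => x /=.
  by move=> zx i _ /=; rewrite in_itv; exact: zx.
by move=> zx i; have := zx i I; rewrite /= in_itv.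
Qed.

Lemma closed_cells S : finite_set S -> closed (cells S).
Proof. by move=> Sfin; apply: closed_bigcup => // z _; exact: closed_tile. Qed.

(** A point interior to the polyomino is surrounded by tiles of [S] only: moving
    slightly from [x] towards the centre of [w] stays in the polyomino and
    enters the open tile of [w], which meets no other tile. *)
Lemma interior_cells S x w : ((cells S)° x)%classic -> tile w x -> S w.
Proof.
move=> /nbhs_rVP[e e0 xS] wx.
pose t := Num.min 1 (e / 2).
have t0 : 0 < t by rewrite lt_min ltr01 divr_gt0.
have t1 : t <= 1 by rewrite ge_min lexx.
have te : t <= e / 2 by rewrite ge_min lexx orbT.
have [i|z Sz zy] := xS (x + t *: (tile_center w - x)).
  rewrite !mxE; have /andP[h1 h2] := wx i.
  by rewrite ltr_distlC; apply/andP; split; nra.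
suff -> : w = z by [].
by apply/esym/(open_tile_eq _ zy)/tile_segment => //; rewrite t0.
Qed.

Definition unit_step (i : 'I_d) : 'rV[int]_d := delta_mx ord0 i.

Lemma center_step z i t j :
  (tile_center z + t *: (tile_center (z + unit_step i) - tile_center z)) ord0 j =
  (z ord0 j)%:~R + 2^-1 + t * (j == i)%:R.
Proof.
by rewrite !mxE eqxx /= intrD; case: (j == i); rewrite ?mulr0 /=; ring.
Qed.

(** The segment between the centres of two cells that share a face crosses that
    face at its centre, so it meets no third tile. *)
Lemma step_component_cellsC S z i : ~ S z -> ~ S (z + unit_step i) ->
  connected_component (~` cells S)%classic (tile_center z) (tile_center (z + unit_step i)).
Proof.
move=> nSz nSz'; apply: segment_component => t /andP[t0 t1] [w Sw wx].
have wz j : j != i -> w ord0 j = z ord0 j.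
  move=> ji; apply: le_anti; have := wx j; rewrite center_step (negbTE ji) mulr0.
  move=> /andP[h1 h2].
  by apply/andP; split; apply: intr_ltD1; lra.
have := wx i; rewrite center_step eqxx mulr1 => /andP[h1 h2].
have wi1 : z ord0 i <= w ord0 i by apply: intr_ltD1; lra.
have wi2 : w ord0 i <= z ord0 i + 1 by apply: intr_ltD1; rewrite intrD mulr1z; lra.
have /orP[/eqP wi|/eqP wi] : (w ord0 i == z ord0 i) || (w ord0 i == z ord0 i + 1) by lia.
  apply: nSz; rewrite (_ : z = w) //; apply/rowP => j.
  by have [->//|/wz ->] := eqVneq j i.
apply: nSz'; rewrite (_ : z + _ = w) //; apply/rowP => j; rewrite !mxE eqxx /=.
by have [->//|ji] := eqVneq j i; rewrite wz //= addr0.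
Qed.

(** Every point of the segment between the two centres is the centre of a cube
    of side 1 that is covered by the two tiles. *)
Lemma step_component_interior S z i : S z -> S (z + unit_step i) ->
  connected_component (cells S)°%classic (tile_center z) (tile_center (z + unit_step i)).
Proof.
move=> Sz Sz'; apply: segment_component => t /andP[t0 t1].
apply: (@nbhs_rV _ _ 2^-1); first by rewrite invr_gt0.
move=> y xy.
have yj j : j != i -> (z ord0 j)%:~R <= y ord0 j <= (z ord0 j)%:~R + 1.
  move=> ji; have := xy j; rewrite center_step (negbTE ji) mulr0 ltr_distlC.
  by move=> /andP[h1 h2]; apply/andP; split; lra.
have := xy i; rewrite center_step eqxx mulr1 ltr_distlC => /andP[h1 h2].
have [yi|yi] := leP (y ord0 i) ((z ord0 i)%:~R + 1).
  exists z => // j; have [->|/yj//] := eqVneq j i.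
  by apply/andP; split; lra.
exists (z + unit_step i) => // j; rewrite !mxE eqxx /=.
have [->|/yj] := eqVneq j i; last by rewrite addr0.
by rewrite intrD mulr1z; apply/andP; split; lra.
Qed.

Definition face_adjacent z w :=
  exists i, w = z + unit_step i \/ z = w + unit_step i.

(** The cells whose tiles contain a given point form a discrete box with
    coordinates varying by at most 1, so two of them are linked by changing one
    coordinate at a time, through cells that contain the point as well. *)
Lemma common_point_adjacent_closed S (A : set 'rV[int]_d) x :
  (forall w, tile w x -> S w) ->
  (forall z w, A z -> S w -> face_adjacent z w -> A w) ->
  forall a b, A a -> tile a x -> tile b x -> A b.
Proof.
move=> xS Aadj a b Aa ax bx.
(* [h k] has its first [k] coordinates from [b], the others from [a]. *)
pose h k : 'rV[int]_d := \row_j (if (j < k)%N then b ord0 j else a ord0 j).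
have hx k : tile (h k) x by move=> j; rewrite mxE; case: ifP.
suff Ah k : A (h k).
  by have := Ah d; congr A; apply/rowP => j; rewrite mxE ltn_ord.
elim: k => [|k IHk].
  by have := Aa; congr A; apply/rowP => j; rewrite mxE ltn0.
have [dk|kd] := leqP d k.
  have := IHk; congr A; apply/rowP => j; rewrite !mxE.
  by rewrite (leq_trans (ltn_ord j) dk) (leq_trans (ltn_ord j) (leqW dk)).
pose i := Ordinal kd.
have hh (c : int) : b ord0 i = a ord0 i + c ->
    h k.+1 = h k + c *: unit_step i.
  move=> bac; apply/rowP => j; rewrite !mxE eqxx /= ltnS.
  have [->|ji] := eqVneq j i; first by rewrite leqnn ltnn bac mulr1.
  rewrite mulr0 addr0 leq_eqVlt.
  rewrite (_ : (j == k :> nat) = false) //.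
  by apply: contraNF ji => /eqP jk; apply/eqP/val_inj.
have ab : a ord0 i <= b ord0 i + 1.
  apply: (@intr_ltD1); rewrite intrD mulr1z.
  by have /andP[? ?] := ax i; have /andP[? ?] := bx i; lra.
have ba : b ord0 i <= a ord0 i + 1.
  apply: (@intr_ltD1); rewrite intrD mulr1z.
  by have /andP[? ?] := ax i; have /andP[? ?] := bx i; lra.
have : [|| b ord0 i == a ord0 i, b ord0 i == a ord0 i + 1 |
        b ord0 i == a ord0 i - 1] by lia.
case/or3P => /eqP bi.
- by have -> : h k.+1 = h k by rewrite (hh 0) ?addr0 // scale0r addr0.
- apply: Aadj IHk (xS _ (hx _)) _; exists i; left.
  by rewrite (hh 1) // scale1r.
- apply: Aadj IHk (xS _ (hx _)) _; exists i; right.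
  by rewrite (hh (-1)) // scaleN1r subrK.
Qed.

(** Discrete form of the connectedness of the interior. If no tile of [A] were
    adjacent to a tile of [S] outside [A], no interior point could belong both
    to a tile of [A] and to a tile outside [A], and the tiles of [A] would cut
    out a proper subset of the interior that is both open and closed. *)
Lemma connected_interior_cut S (A : set 'rV[int]_d) a b :
  finite_set S -> connected (cells S)°%classic ->
  (A `<=` S)%classic -> A a -> S b -> ~ A b ->
  exists z w, [/\ A z, S w, ~ A w & face_adjacent z w].
Proof.
move=> Sfin Scon AS Aa Sb nAb; apply: contrapT => Acut.
have Aadj z w : A z -> S w -> face_adjacent z w -> A w.
  move=> Az Sw zw; apply: contrapT => nAw; apply: Acut.
  by exists z, w.
have intA x : (cells S)°%classic x ->
    cells A x <-> ~ cells (S `\` A)%classic x.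
  move=> Sx; split=> [[u Au ux] [v [Sv nAv] vx]|].
    apply: nAv; apply: (common_point_adjacent_closed _ Aadj Au ux vx).
    by move=> w; exact: interior_cells.
  move=> nSAx; have [u Su ux] := interior_subset Sx.
  exists u => //; apply: contrapT => nAu; apply: nSAx.
  by exists u.
have : ((cells S)° `&` cells A = (cells S)°)%classic.
  apply: Scon.
  - exists (tile_center a); split; last exact/cells_center.
    exact/(open_tile_interior (AS _ Aa))/open_tile_tile_center.
  - exists (~` cells (S `\` A))%classic.
      by apply/closed_openC/closed_cells/(sub_finite_set _ Sfin) => ? [].
    by apply/seteqP; split => x [Sx Ax]; split => //; apply/(intA x Sx).
  - exists (cells A) => //.
    exact/closed_cells/(sub_finite_set AS Sfin).
move=> /seteqP [_ /(_ (tile_center b))] [|_ /cells_center//].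
exact/(open_tile_interior Sb)/open_tile_tile_center.
Qed.

Lemma adjacent_component_cellsC S z w : ~ S z -> ~ S w -> face_adjacent z w ->
  connected_component (~` cells S)%classic (tile_center z) (tile_center w).
Proof.
move=> nSz nSw [i [wz|zw]]; subst.
  exact: step_component_cellsC.
exact/connected_component_sym/step_component_cellsC.
Qed.

Lemma adjacent_component_interior S z w : S z -> S w -> face_adjacent z w ->
  connected_component (cells S)°%classic (tile_center z) (tile_center w).
Proof.
move=> Sz Sw [i [wz|zw]]; subst.
  exact: step_component_interior.
exact/connected_component_sym/step_component_interior.
Qed.

Lemma bounded_setE A :
  bounded_set A <-> exists M : R, forall x i, A x -> `|x ord0 i| <= M.
Proof.
split=> [[M [_ MA]]|[M MA]].
  exists (M + 1) => x i Ax; apply: le_trans (MA (M + 1) _ x Ax); last by rewrite ltrDl.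
  rewrite /Num.norm /= mx_normrE.
  exact: (le_bigmax _ (fun ij : 'I_1 * 'I_d => `|x ij.1 ij.2|) (ord0, i)).
exists (Num.max 0 M); split; first by rewrite num_real.
move=> K MK x Ax; rewrite /= /Num.norm /= mx_normrE.
apply/bigmax_leP; split; first by rewrite (le_trans _ (ltW MK)) // le_max lexx.
move=> [j i] _ /=; rewrite (ord1 j) (le_trans (MA x i Ax)) //.
by rewrite (le_trans _ (ltW MK)) // le_max lexx orbT.
Qed.

(** The sign [s] lets the ray run in either direction along axis [i]. *)
Lemma ray_unbounded S z i (s : int) : s = 1 \/ s = -1 ->
  (forall k : nat, ~ S (z + (s * k%:Z) *: unit_step i)) ->
  ~ bounded_set (connected_component (~` cells S)%classic (tile_center z)).
Proof.
move=> s1 nS; pose r (k : nat) := z + (s * k%:Z) *: unit_step i.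
have rS (k : nat) : r k.+1 = r k + s *: unit_step i.
  by rewrite /r -addrA -scalerDl; congr (_ + _ *: _); lia.
have zr k : connected_component (~` cells S)%classic (tile_center z) (tile_center (r k)).
  elim: k => [|k IHk].
    rewrite /r mulr0 scale0r addr0; apply: connected_component_refl.
    move/cells_center; have := nS 0; by rewrite mulr0 scale0r addr0.
  apply: connected_component_trans IHk _.
  apply: adjacent_component_cellsC; [exact: nS|exact: nS|exists i].
  rewrite rS; case: s1 => ->; [left|right].
    by rewrite scale1r.
  by rewrite scaleN1r subrK.
move=> /bounded_setE [M zM].
have [k Mk] : exists k : nat, M + `|tile_center z ord0 i| < k%:R.
  exists (Num.truncn (M + `|tile_center z ord0 i|)).+1; exact: truncnS_gt.
have := zM _ i (zr k); apply/negP; rewrite -ltNge.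
have -> : tile_center (r k) ord0 i = tile_center z ord0 i + (s * k%:Z)%:~R.
  by rewrite !mxE !eqxx mulr1 intrD /=; ring.
have sk : `|(s * k%:Z)%:~R : R| = k%:R.
  rewrite intrM normrM; case: s1 => ->; rewrite ?rmorphN ?mulr1z ?normrN normr1 mul1r;
  by rewrite -pmulrn normr_nat.
have := ler_normB ((s * k%:Z)%:~R + tile_center z ord0 i : R) (tile_center z ord0 i).
rewrite addrK sk [X in `|X| + _]addrC; lra.
Qed.

Lemma tile_cover x : exists z, tile z x.
Proof.
exists (\row_i Num.floor (x ord0 i)) => i; rewrite mxE floor_le_tmp /=.
by rewrite ltW // -[1]/(1%:~R) -intrD floorD1_gt.
Qed.

Lemma holes_center S H : holes (cells S) H ->
  exists2 z, ~ S z &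
    H = connected_component (~` cells S)%classic (tile_center z).
Proof.
move=> [_ [x nSx ->]]; have [z zx] := tile_cover x.
have nSz : ~ S z by move=> Sz; apply: nSx; exists z.
exists z => //; apply: same_connected_component.
exact: (to_center_component nSx (open_tile_cellsC nSz) zx).
Qed.

(** Going down in direction [i] from a cell of a hole must meet [S], since
    otherwise a ray of missing cells would make the hole unbounded. The first
    tile that is met is the one sought. *)
Lemma holes_below S H i : holes (cells S) H -> exists z,
  [/\ S z, ~ S (z + unit_step i) &
   H = connected_component (~` cells S)%classic (tile_center (z + unit_step i))].
Proof.
move=> HS; have [z nSz HE] := holes_center HS; case: HS => Hb _.
pose p k := `[< S (z - (k%:Z) *: unit_step i) >].
have pex : exists k, p k.
  apply: contrapT => np; rewrite HE in Hb; move: Hb.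
  apply: (@ray_unbounded _ _ i (-1)); first by right.
  move=> k Sk; apply: np; exists k; apply/asboolP.
  by move: Sk; rewrite mulN1r scaleNr.
have [k /asboolP Sk kmin] := ex_minnP pex.
have kS (j : nat) : (j < k)%N -> ~ S (z - (j%:Z) *: unit_step i).
  by move=> jk /asboolP /kmin; rewrite leqNgt jk.
have zj (j : nat) : (j < k)%N -> connected_component (~` cells S)%classic
    (tile_center z) (tile_center (z - (j%:Z) *: unit_step i)).
  elim: j => [k0|j IHj jk].
    rewrite scale0r subr0; apply: connected_component_refl.
    by move=> /cells_center.
  apply: connected_component_trans (IHj (ltnW jk)) _.
  apply: adjacent_component_cellsC; [exact/kS/ltnW|exact: kS|exists i; right].
  by rewrite -[j.+1]addn1 PoszD scalerDl scale1r opprD addrA subrK.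
case: k => [|k] in Sk kmin kS zj *.
  by rewrite scale0r subr0 in Sk.
have Ek : z - k.+1%:Z *: unit_step i + unit_step i = z - k%:Z *: unit_step i.
  by rewrite -[k.+1]addn1 PoszD scalerDl scale1r opprD addrA subrK.
exists (z - k.+1%:Z *: unit_step i); rewrite Ek; split=> //; first exact: kS.
rewrite HE; exact/same_connected_component/zj.
Qed.

(** All facets of the tile of [z] are covered by its neighbours, so the
    closed tile and the open tile have the same trace on the complement. This
    trace is therefore open and closed there. *)
Lemma isolated_component S z : ~ S z -> (forall w, face_adjacent z w -> S w) ->
  (connected_component (~` cells S) (tile_center z) `<=` open_tile z)%classic.
Proof.
move=> nSz zS.
have opz x : (~` cells S)%classic x -> tile z x -> open_tile z x.
  move=> nSx zx i; have /andP[h1 h2] := zx i.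
  rewrite !lt_neqAle h1 h2 !andbT; apply/andP; split; apply/eqP => xi; apply: nSx.
    exists (z - unit_step i); first by apply: zS; exists i; right; rewrite subrK.
    move=> j; rewrite !mxE eqxx /=; have [->|_] := eqVneq j i.
      by rewrite intrB mulr1z xi; apply/andP; split; lra.
    by rewrite subr0; exact: zx.
  exists (z + unit_step i); first by apply: zS; exists i; left.
  move=> j; rewrite !mxE eqxx /=; have [->|_] := eqVneq j i.
    by rewrite intrD mulr1z xi; apply/andP; split; lra.
  by rewrite addr0; exact: zx.
set K := connected_component _ _.
have KS : (K `<=` ~` cells S)%classic by exact: connected_component_sub.
have : (K `&` open_tile z = K)%classic.
  apply: (@component_connected _ (~` cells S)%classic (tile_center z)).
  - exists (tile_center z); split; last exact: open_tile_tile_center.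
    by apply: connected_component_refl; move=> /cells_center.
  - exists (open_tile z) => //; rewrite openE => x; exact: nbhs_open_tile.
  - exists (tile z); first exact: closed_tile.
    apply/seteqP; split => x [Kx zx]; split=> //; first exact: open_tileW.
    by apply: opz => //; exact: KS.
by move=> /setIidPl.
Qed.

Lemma isolated_hole S z : ~ S z -> (forall w, face_adjacent z w -> S w) ->
  holes (cells S) (connected_component (~` cells S)%classic (tile_center z)).
Proof.
move=> nSz zS; split; last first.
  by exists (tile_center z) => // /cells_center.
apply/bounded_setE.
exists (\sum_i (`|(z ord0 i)%:~R| + 1)) => x i /(isolated_component nSz zS) zx.
have /andP[h1 h2] := zx i.
rewrite (bigD1 i) //= ler_wpDr ?sumr_ge0 //.
by rewrite ler_norml; have := ler_norm ((z ord0 i)%:~R : R);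
  have := ler_norm (- (z ord0 i)%:~R : R); rewrite normrN; lra.
Qed.

Lemma isolated_hole_inj S z w : ~ S z -> ~ S w ->
  (forall u, face_adjacent z u -> S u) ->
  connected_component (~` cells S)%classic (tile_center z) =
  connected_component (~` cells S)%classic (tile_center w) -> z = w.
Proof.
move=> nSz nSw zS E.
have : connected_component (~` cells S)%classic (tile_center w) (tile_center w).
  by apply: connected_component_refl => /cells_center.
by rewrite -E => /(isolated_component nSz zS)/open_tileW/tile_tile_center.
Qed.

Lemma connected_cells S z0 : S z0 ->
  (forall z, S z ->
    connected_component (cells S)°%classic (tile_center z0) (tile_center z)) ->
  connected (cells S)°%classic.
Proof.
move=> Sz0 conn; have -> : ((cells S)° =
    connected_component (cells S)° (tile_center z0))%classic; last first.
  exact: component_connected.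
apply/seteqP; split; last exact: connected_component_sub.
move=> x Sx; have [z Sz zx] := interior_subset Sx.
apply: connected_component_trans (conn z Sz) _.
apply: connected_component_sym; apply: to_center_component => //.
exact: open_tile_interior.
Qed.

End Geometry.

(** * Shadows: a weak Loomis-Whitney inequality *)

(** Taking [K]-th roots turns the hypothesis into the linear bounds
    [a i <= r * p i] with [r ^+ K = q], which can be summed. The algebraic
    numbers serve only to provide the root. *)
Lemma sum_exp_le (I : Type) (s : seq I) (a p : I -> nat) (q K : nat) :
  (0 < K)%N -> (forall i, a i ^ K <= q * p i ^ K)%N ->
  ((\sum_(i <- s) a i) ^ K <= q * (\sum_(i <- s) p i) ^ K)%N.
Proof.
move=> K0 apq; pose r : algC := K.-root q%:R.
have rK : r ^+ K = q%:R by rewrite /r rootCK.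
have r0 : 0 <= r by rewrite /r rootC_ge0 ?ler0n.
have arp i : (a i)%:R <= r * (p i)%:R.
  rewrite -(@ler_pXn2r _ K) ?nnegrE ?mulr_ge0 ?ler0n //.
  by rewrite exprMn rK -!natrX -natrM ler_nat.
rewrite -(@ler_nat algC) natrM !natrX -rK -exprMn.
rewrite ler_pXn2r ?nnegrE ?mulr_ge0 ?ler0n //.
by rewrite !natr_sum mulr_sumr; apply: ler_sum => i _.
Qed.

Section Shadows.
Context {d : nat}.
Implicit Types (z : 'rV[int]_d) (S : {fset 'rV[int]_d}).

(** Projection along axis [i], with image kept in the same space so that
    repeated slicing does not change the dimension. *)
Definition zero_coord i z : 'rV[int]_d :=
  \row_j (if j == i then 0 else z ord0 j).

Definition shadow i S : {fset 'rV[int]_d} := [fset zero_coord i z | z in S]%fset.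

Definition slice l S (t : int) : {fset 'rV[int]_d} :=
  [fset z in S | z ord0 l == t]%fset.

Definition heights l S : {fset int} := [fset z ord0 l | z : 'rV[int]_d in S]%fset.

Lemma card_slices l S : #|` S| = (\sum_(t <- heights l S) #|` slice l S t|)%N.
Proof.
rewrite card_fset_sum1 (partition_big_imfset _ (fun z : 'rV[int]_d => z ord0 l)) /=.
apply: eq_bigr => t _; rewrite card_fset_sum1 [RHS]big_fset /=.
by [].
Qed.

Lemma zero_coordE i l z : l != i -> zero_coord i z ord0 l = z ord0 l.
Proof. by move=> li; rewrite mxE (negbTE li). Qed.

Lemma heights_shadow i l S : l != i -> heights l (shadow i S) = heights l S.
Proof.
move=> li; apply/fsetP => t; apply/imfsetP/imfsetP => /= -[z zS ->].
  by case/imfsetP: zS => /= w wS ->; exists w => //; rewrite zero_coordE.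
by exists (zero_coord i z); [exact: in_imfset|rewrite zero_coordE].
Qed.

Lemma slice_shadow i l S t : l != i ->
  slice l (shadow i S) t = shadow i (slice l S t).
Proof.
move=> li; apply/fsetP => z; rewrite !inE /=; apply/andP/imfsetP => /=.
  case=> /imfsetP[/= w wS ->]; rewrite zero_coordE // => /eqP wt.
  by exists w => //; rewrite !inE wS wt eqxx.
case=> w; rewrite !inE => /andP[wS wt] ->; rewrite zero_coordE //; split => //.
exact: in_imfset.
Qed.

(** Induction on the number [k.+1] of coordinates that vary on [S]. Cut [S] into
    slices at constant height in coordinate [k.+1]. A slice has at most [q]
    elements, [q] being the size of the shadow along that coordinate, and its
    own shadows are the slices of the remaining shadows of [S]. Multiplying the
    induction hypothesis for a slice by this bound gives an estimate that
    [sum_exp_le] sums over all slices. *)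
Lemma card_le_sum_shadows_upto S k : (k < d)%N -> S != fset0 ->
  (forall x y (j : 'I_d), x \in S -> y \in S -> (k < j)%N -> x ord0 j = y ord0 j) ->
  (#|` S| ^ k <= (\sum_(i < d | (i <= k)%N) #|` shadow i S|) ^ k.+1)%N.
Proof.
elim: k S => [|k IHk] S kd S0 Seq.
  rewrite expn0 expn1 (bigD1 (Ordinal kd)) //= addn_gt0 cardfs_gt0.
  have /fset0Pn [z zS] := S0.
  apply/orP; left; apply/fset0Pn; exists (zero_coord (Ordinal kd) z).
  exact: in_imfset.
pose l := Ordinal kd; pose q := #|` shadow l S|.
pose p t := (\sum_(i < d | (i <= k)%N) #|` shadow i (slice l S t)|)%N.
have il (i : 'I_d) : (i <= k)%N -> l != i.
  by move=> ik; rewrite -val_eqE /= neq_ltn ltnS ik orbT.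
have slice_le t : (#|` slice l S t| <= q)%N.
  have /card_in_imfsetP/eqP <- : {in slice l S t &, injective (zero_coord l)}.
    move=> x y /=; rewrite !inE => /andP[xS /eqP xt] /andP[yS /eqP yt] /rowP xy.
    apply/rowP => j; have := xy j; rewrite !mxE; case: eqP => [->|//].
    by rewrite xt yt.
  apply: fsubset_leq_card; apply/fsubsetP => w /imfsetP[/= z].
  rewrite !inE => /andP[zS _] ->; exact: in_imfset.
have slice_iso t : (#|` slice l S t| ^ k.+1 <= q * p t ^ k.+1)%N.
  have [->|St0] := eqVneq (slice l S t) fset0; first by rewrite cardfs0 exp0n.
  rewrite expnS; apply: leq_mul; first exact: slice_le.
  apply: IHk => //; first exact: ltnW.
  move=> x y j; rewrite !inE => /andP[xS /eqP xt] /andP[yS /eqP yt] kj.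
  have [->|jl] := eqVneq j l; first by rewrite xt yt.
  apply: Seq => //; rewrite ltn_neqAle kj andbT.
  by apply: contra jl => /eqP kj'; apply/eqP/val_inj.
have := sum_exp_le (heights l S) (ltn0Sn k) slice_iso.
rewrite -card_slices => /leq_trans; apply.
have -> : (\sum_(t <- heights l S) p t)%N =
    (\sum_(i < d | (i <= k)%N) #|` shadow i S|)%N.
  rewrite exchange_big /=; apply: eq_bigr => i ik.
  rewrite (card_slices l (shadow i S)) heights_shadow ?il //.
  by apply: eq_bigr => t _; rewrite slice_shadow // il.
have -> : (\sum_(i < d | (i <= k.+1)%N) #|` shadow i S|)%N =
    (q + \sum_(i < d | (i <= k)%N) #|` shadow i S|)%N.
  rewrite (bigD1 l) //=; congr (_ + _)%N; apply: eq_bigl => i.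
  by rewrite -val_eqE /= andbC -ltn_neqAle ltnS.
by rewrite [leqRHS]expnS leq_mul ?leq_addr // leq_exp2r // leq_addl.
Qed.

Lemma card_le_sum_shadows S : (0 < d)%N -> S != fset0 ->
  (#|` S| ^ d.-1 <= (\sum_(i < d) #|` shadow i S|) ^ d)%N.
Proof.
move=> d0 S0; have dd : (d.-1 < d)%N by rewrite prednK.
have jd (j : 'I_d) : (j <= d.-1)%N by rewrite -ltnS prednK ?ltn_ord.
have := card_le_sum_shadows_upto dd S0.
rewrite prednK // (eq_bigl xpredT) => [|i]; last exact: jd.
by apply=> x y j _ _; rewrite leqNgt ltn_ord.
Qed.
End Shadows.

(** * Counting tiles by their successor in each direction *)

Section Counting.
Context {d : nat}.
Implicit Types (z w : 'rV[int]_d) (S A : {fset 'rV[int]_d}).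

Lemma card_fset_sep S (p : pred 'rV[int]_d) :
  #|` [fset z in S | p z]%fset| = (\sum_(z <- S) p z)%N.
Proof. by rewrite card_fset_sum1 big_fset /= big_mkcond. Qed.

Definition forward i S : {fset 'rV[int]_d} :=
  [fset z in S | (z + unit_step i)%R \in S]%fset.

(** A connected graph on n vertices has at least n - 1 edges; each edge is
    counted once, at its lower end. The proof grows a subset of [S] from one
    tile, and each added tile brings a new edge along the cut. *)
Lemma card_forward_ge S : S != fset0 ->
  (forall A a b, (A `<=` S)%fset -> a \in A -> b \in S -> b \notin A ->
     exists z w, [/\ z \in A, w \in S, w \notin A & face_adjacent z w]) ->
  (#|` S| <= (\sum_(i < d) #|` forward i S|).+1)%N.
Proof.
move=> /fset0Pn[a aS] cut.
suff grow m : (m < #|` S|)%N -> exists A,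
    [/\ (A `<=` S)%fset, a \in A, #|` A| = m.+1 &
      (m <= \sum_(i < d) #|` forward i A|)%N].
  have S0 : (0 < #|` S|)%N by rewrite cardfs_gt0; apply/fset0Pn; exists a.
  have [|A [AS _ Am Ale]] := grow #|` S|.-1; first by rewrite prednK.
  rewrite prednK // in Am.
  suff <- : A = S by rewrite Am -(prednK S0) ltnS.
  by apply/eqP; rewrite eqEfcard AS Am leqnn.
elim: m => [_|m IHm mS].
  exists [fset a]%fset; split=> //; last by rewrite cardfs1.
    by rewrite fsub1set.
  by rewrite inE.
have [A [AS aA Am Ale]] := IHm (ltnW mS).
have [b bS bA] : exists2 b, b \in S & b \notin A.
  have /fsubsetPn[b bS bA] : ~~ (S `<=` A)%fset.
    by apply/negP => /fsubset_leq_card; rewrite Am leqNgt mS.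
  by exists b.
have [z [w [zA wS wA [i zw]]]] := cut _ _ _ AS aA bS bA.
have sub j : (forward j A `<=` forward j (w |` A))%fset.
  apply/fsubsetP => u; rewrite !inE /= => /andP[uA uA'].
  by rewrite uA uA' !orbT.
exists (w |` A)%fset; split.
- by rewrite fsubUset fsub1set wS.
- by rewrite !inE aA orbT.
- by rewrite cardfsU1 wA Am.
- rewrite (bigD1 i) //=; apply: leq_ltn_trans Ale _.
  rewrite (bigD1 i) //= -addSn leq_add //.
    apply: fproper_ltn_card; rewrite fproperE sub /=; apply/fsubsetPn.
    case: zw => [wz|zw].
      exists z; first by rewrite !inE /= zA -wz eqxx orbT.
      by rewrite !inE /= -wz (negbTE wA) andbF.
    exists w; first by rewrite !inE /= eqxx -zw zA orbT.
    by rewrite !inE /= (negbTE wA).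
  by apply: leq_sum => j _; exact/fsubset_leq_card.
Qed.

(** The last tile of a line along axis [i] is one of these, hence the bound on
    shadows that follows. *)
Definition summits i S : {fset 'rV[int]_d} :=
  [fset z in S | `[< forall k : nat, (z + k.+1%:Z *: unit_step i)%R \notin S >]]%fset.

Lemma shadow_summits i S : (#|` shadow i S| <= #|` summits i S|)%N.
Proof.
have le : (#|` shadow i (summits i S)| <= #|` summits i S|)%N.
  exact: leq_imfset_card.
apply: leq_trans le; apply/fsubset_leq_card/fsubsetP => _ /imfsetP[z /= zS ->].
pose p k := (z + k%:Z *: unit_step i) \in S.
have p0 : p 0 by rewrite /p scale0r addr0.
have pb k : p k -> (k <= \sum_(w <- S) `|((w - z)%R : 'rV[int]_d) ord0 i|)%N.
  move=> pk; rewrite (big_fsetD1 _ pk) /=.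
  by rewrite [z + _]addrC addrK !mxE !eqxx mulr1 absz_nat leq_addr.
have [k pk kmax] := ex_maxnP (ex_intro _ 0%N p0) pb.
apply/imfsetP; exists (z + k%:Z *: unit_step i).
  rewrite !inE /= -[_ \in S]/(p k) pk; apply/asboolP => j.
  rewrite -addrA -scalerDl -PoszD; apply/negP => /kmax.
  by rewrite addnS ltnNge leq_addr.
by apply/rowP => j; rewrite !mxE eqxx /=; case: eqP; rewrite ?mulr0 ?addr0.
Qed.

Section Holes.
Context (R : realType).

Definition ceilings i S : {fset 'rV[int]_d} :=
  [fset z in S | `[< (z + unit_step i)%R \notin S /\
    bounded_set (connected_component (~` @cells R d [set` S])%classic
       (tile_center (z + unit_step i)%R)) >]]%fset.

(** Sending a tile to the component of the next cell covers all holes, by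
    [holes_below]. *)
Lemma holes_ceilings i S :
  (holes (@cells R d [set` S])%classic #<= [set` ceilings i S]%classic)%card.
Proof.
apply: card_le_trans (card_image_le (fun z => connected_component
  (~` @cells R d [set` S])%classic (tile_center (z + unit_step i))) _).
apply: subset_card_le => H HS.
have [z [zS nS HE]] := holes_below i HS.
exists z => //=; rewrite !inE /= zS; apply/asboolP; split; first exact/negP.
by rewrite -HE; case: HS.
Qed.

(** Summits and ceilings exclude each other because the missing ray above a
    summit is in an unbounded component. *)
Lemma direction_count i S :
  (#|` forward i S| + #|` summits i S| + #|` ceilings i S| <= #|` S|)%N.
Proof.
rewrite !card_fset_sep card_fset_sum1 -!big_split /=; apply: leq_sum => z _.
case: (boolP (z + _ \in S)) => [zS|nzS] /=.
  rewrite !asboolF //; first by case.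
  by move=> /(_ 0%N); rewrite scale1r zS.
case: asboolP => [zS|_] /=; last by case: asboolP.
rewrite asboolF // => -[_]; apply: (@ray_unbounded R d _ _ i 1); first by left.
move=> k; rewrite mul1r -addrA -{1}[unit_step i]scale1r -scalerDl -PoszD add1n.
exact/negP.
Qed.

Lemma holes_count S : (0 < d)%N -> S != fset0 ->
  connected (@cells R d [set` S])°%classic ->
  exists2 h : nat, (holes (@cells R d [set` S]) #= `I_h)%card &
    (#|` S| + \sum_(i < d) #|` shadow i S| + d * h <= (d * #|` S|).+1)%N.
Proof.
move=> d0 S0 Scon.
have /finite_setP[h hE] : finite_set (holes (@cells R d [set` S])).
  exact: card_le_finite (holes_ceilings (Ordinal d0) S) (finite_fset _).
exists h => //.
have hi i : (h <= #|` ceilings i S|)%N.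
  have : ([set` ceilings i S] #= `I_#|` ceilings i S|)%card.
    exact/card_eq_fsetP.
  move: hE; rewrite !card_eq_le => /andP[_ hle] /andP[cle _].
  rewrite -card_le_II.
  exact: card_le_trans (card_le_trans hle (holes_ceilings i S)) cle.
have := @card_forward_ge S S0 _.
have dS : (d * #|` S| = \sum_(i < d) #|` S|)%N by rewrite sum_nat_const card_ord.
have dh : (d * h = \sum_(i < d) h)%N by rewrite sum_nat_const card_ord.
rewrite dS dh => edges.
apply: (@leq_trans (\sum_(i < d)
  (#|` forward i S| + #|` summits i S| + #|` ceilings i S|)).+1); last first.
  by rewrite ltnS; apply: leq_sum => i _; exact: direction_count.
rewrite !big_split /= -!addSn; apply: leq_add; last by apply: leq_sum => i _.
apply: leq_add; last by apply: leq_sum => i _; exact: shadow_summits.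
apply: edges => A a b AS aA bS bA.
have [||||||z [w [zA wS wA zw]]] :=
  @connected_interior_cut R d [set` S] [set` A] a b => //.
  by move=> x /=; exact: (fsubsetP AS).
  exact/negP.
by exists z, w; split=> //; exact/negP.
Qed.

End Holes.
End Counting.

(** * Periodic counting in a box *)

Lemma sum_periodic_window (b : nat -> nat) (q c : nat) :
  (forall r, b (r + q)%N = b r) ->
  (\sum_(v < q) b (v + c) = \sum_(v < q) b v)%N.
Proof.
move=> bq; elim: c => [|c IHc]; first by apply: eq_bigr => v _; rewrite addn0.
rewrite -IHc; case: q bq {IHc} => [|q] bq; first by rewrite !big_ord0.
rewrite big_ord_recr big_ord_recl /= addnC; congr (_ + _)%N.
  by rewrite addnS -addSn addnC bq add0n.
by apply: eq_bigr => v _; rewrite /bump /= add1n addnS.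
Qed.

Lemma sum_periodic (b : nat -> nat) (q K c : nat) :
  (forall r, b (r + q)%N = b r) ->
  (\sum_(v < q * K) b (v + c) = K * \sum_(v < q) b v)%N.
Proof.
move=> bq; elim: K c => [|K IHK] c; first by rewrite muln0 big_ord0.
rewrite mulnS big_split_ord /= mulSn sum_periodic_window //; congr (_ + _)%N.
by rewrite -(IHK (q + c)%N); apply: eq_bigr => v _; rewrite addnCA addnA.
Qed.

(** Double counting of pairs (function, value): exchanging the value with the
    [i]-th value of the function is an involution. It replaces a decomposition
    of the function space as a product. *)
Lemma sum_ffun_resample (I T : finType) (i : I) (F : {ffun I -> T} -> nat) :
  (\sum_(f : {ffun I -> T}) \sum_(v : T) F [ffun j => if j == i then v else f j] =
   #|T| * \sum_f F f)%N.
Proof.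
pose sw (p : {ffun I -> T} * T) : {ffun I -> T} * T :=
  ([ffun j => if j == i then p.2 else p.1 j], p.1 i).
have swK : involutive sw.
  move=> [f v]; rewrite /sw /= ffunE eqxx; congr pair.
  by apply/ffunP => j; rewrite !ffunE; case: eqP => [->|].
rewrite pair_big /= (reindex_inj (inv_inj swK)) /=.
rewrite (eq_bigr (fun p => F p.1)) => [|[f v] _ /=]; last first.
  by congr F; apply/ffunP => j; rewrite !ffunE /=; case: eqP => [->|].
rewrite -(pair_big xpredT xpredT (fun f (_ : T) => F f)) /=.
by rewrite big_distrr /=; apply: eq_bigr => f _; rewrite sum_nat_const.
Qed.

(** The weight of coordinate 0 is 1, so when this coordinate runs over a whole
    number [K] of periods the weighted sum takes each residue [K] times,
    whatever the other coordinates are. *)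
Lemma card_periodic_box (d q K : nat) (a : 'I_d.+1 -> nat) (b : nat -> bool) :
  a ord0 = 1%N -> (forall r, b (r + q)%N = b r) ->
  (#|[pred f : {ffun 'I_d.+1 -> 'I_(q * K)} |
      b (\sum_j a j * (f j).+1)%N]|
   = (q * K) ^ d * K * \sum_(r < q) b r)%N.
Proof.
move=> a0 bq; set M := (q * K)%N.
pose F (f : {ffun 'I_d.+1 -> 'I_M}) : nat := b (\sum_j a j * (f j).+1)%N.
have -> : #|[pred f : {ffun 'I_d.+1 -> 'I_M} | b (\sum_j a j * (f j).+1)%N]|
    = (\sum_f F f)%N by rewrite -sum1_card big_mkcond.
have := sum_ffun_resample ord0 F.
have -> : (\sum_(f : {ffun 'I_d.+1 -> 'I_M}) \sum_(v : 'I_M)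
      F [ffun j => if j == ord0 then v else f j] =
    M * (M ^ d * K * \sum_(r < q) b r))%N.
  rewrite (eq_bigr (fun=> K * \sum_(r < q) b r)%N) => [|f _].
    by rewrite sum_nat_const card_ffun !card_ord expnS !mulnA.
  pose c := (\sum_(j < d) a (lift ord0 j) * (f (lift ord0 j)).+1)%N.
  rewrite -(@sum_periodic (fun r => b r) q K c.+1) => [|r]; last by rewrite bq.
  apply: eq_bigr => v _; rewrite /F big_ord_recl ffunE eqxx a0 mul1n addSnnS.
  congr (nat_of_bool (b (v + _.+1)%N)).
  by apply: eq_bigr => j _; rewrite ffunE.
rewrite card_ord; have [M0|M0] := posnP M; last first.
  by move/eqP; rewrite eqn_pmul2l // eq_sym => /eqP.
move=> _; rewrite /M in M0 *; rewrite [RHS](_ : _ = 0)%N.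
  by rewrite big1 // => f _; have := leq_trans (ltn_ord (f ord0)) (eq_leq M0).
move/eqP: M0; rewrite muln_eq0 => /orP[/eqP -> |/eqP -> ].
  by rewrite big_ord0 muln0.
by rewrite muln0 mul0n.
Qed.

Definition pit (m r : nat) : bool := ~~ odd r && ~~ (2 * m %| r)%N.

Lemma pit_periodic m r : pit m (r + 2 * m) = pit m r.
Proof. by rewrite /pit oddD mul2n odd_double addbF -mul2n dvdn_addl. Qed.

Lemma sum_pit m : (0 < m)%N -> (\sum_(r < 2 * m) pit m r = m.-1)%N.
Proof.
move=> m0.
have ev k : (\sum_(r < 2 * k) ~~ odd r = k)%N.
  elim: k => [|k IHk]; first by rewrite big_ord0.
  by rewrite mulnS add2n !big_ord_recr /= IHk mul2n odd_double /=; lia.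
have := ev m; have := m0; case: m m0 => // m _ _.
rewrite mulnS add2n !big_ord_recl /= add1n => /eqP; rewrite eqSS => /eqP E.
rewrite !add0n -[RHS]E add0n; apply: eq_bigr => i _.
by rewrite /pit gtnNdvd ?andbT // /bump /=; have := ltn_ord i; lia.
Qed.

(** * The sponge: a box with isolated pits *)

Section Construction.
Context {d : nat}.
Local Notation D := d.+2.
Local Notation m := (2 * d + 3)%N.
Implicit Types (z w : 'rV[int]_D) (N K : nat).

(** With [D] coordinates, [m] is [2 * D - 1], the weight of the last one. *)
Definition phase z : int := \sum_(j < D) (2 * j + 1)%N%:Z * z ord0 j.

Definition pit_phase (r : int) : bool := (2 %| r)%Z && ~~ ((2 * m)%N %| r)%Z.

Definition box N : {fset 'rV[int]_D} :=
  [fset (\row_j (f j : nat)%:Z)%R | f : {ffun 'I_D -> 'I_N} in predT]%fset.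

Definition side K : nat := (2 * m * K)%N.

Definition pits K : {fset 'rV[int]_D} :=
  [fset z in box (side K + 2)%N |
     [forall j : 'I_D, (0%R < z ord0 j <= (side K)%:Z)%R] && pit_phase (phase z)]%fset.

Definition sponge K : {fset 'rV[int]_D} := (box (side K + 2)%N `\` pits K)%fset.

Lemma boxP N z :
  reflect (forall j, 0 <= z ord0 j < N%:Z) (z \in box N).
Proof.
rewrite /box; apply: (iffP (imfsetP _ _ _ _)) => /= [[f _ ->] j|zN].
  by rewrite mxE /= ltz_nat ltn_ord.
have zj j : (`|z ord0 j| < N)%N by have := zN j; lia.
exists [ffun j => Ordinal (zj j)] => //.
by apply/rowP => j; rewrite mxE ffunE /= gez0_abs //; have /andP[] := zN j.
Qed.

Lemma card_box N : #|` box N| = (N ^ D)%N.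
Proof.
rewrite card_imfset /=; last first.
  move=> f g /rowP fg; apply/ffunP => j; apply/val_inj.
  by have := fg j; rewrite !mxE => -[].
by rewrite -cardE card_ffun !card_ord.
Qed.

Lemma pitsP K z : reflect
  ((forall j, 0 < z ord0 j <= (side K)%:Z) /\ pit_phase (phase z)) (z \in pits K).
Proof.
rewrite !inE /=; apply: (iffP and3P) => [[_ /forallP zK ?]|[zK zp]] //.
split=> //; last exact/forallP.
by apply/boxP => j; have := zK j; lia.
Qed.

Lemma pit_phase_nat (r : nat) : pit_phase r%:Z = pit m r.
Proof. by rewrite /pit_phase /pit !dvdzE /= dvdn2. Qed.

Lemma card_pits K : #|` pits K| = (side K ^ d.+1 * K * (2 * d + 2))%N.
Proof.
pose a (j : 'I_D) := (2 * j + 1)%N.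
pose h (f : {ffun 'I_D -> 'I_(side K)}) : 'rV[int]_D := \row_j (f j).+1%:Z.
have phaseh f : phase (h f) = (\sum_j a j * (f j).+1)%N%:Z.
  rewrite /phase (big_morph Posz PoszD (erefl _)); apply: eq_bigr => j _.
  by rewrite mxE PoszM.
pose B := [pred f : {ffun 'I_D -> 'I_(side K)} | pit m (\sum_j a j * (f j).+1)%N].
have -> : pits K = [fset h f | f in B]%fset.
  (* The type of [z] is restated as a row vector for integer arithmetic. *)
  apply/fsetP => z; move: z => z'; pose z : 'rV[int]_D := z'; rewrite -/z.
  apply/pitsP/imfsetP => /= [[zK zp]|[f]].
    have zj j : (`|z ord0 j|.-1 < side K)%N.
      by have := zK j; lia.
    have zh : z = h [ffun j => Ordinal (zj j)].
      apply/rowP => j; have /andP[z0 _] := zK j.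
      by rewrite mxE ffunE /= prednK ?gez0_abs // ?(ltW z0) // absz_gt0 gt_eqF.
    exists [ffun j => Ordinal (zj j)] => //.
    by rewrite inE /= -pit_phase_nat -phaseh -zh.
  rewrite inE /= -pit_phase_nat -phaseh => fp ->; split=> // j.
  by rewrite mxE ltz_nat lez_nat /= ltn_ord.
rewrite card_imfset /=; last first.
  move=> f g /rowP fg; apply/ffunP => j; apply/val_inj.
  by have := fg j; rewrite !mxE => -[].
rewrite -cardE card_periodic_box //; last exact: pit_periodic.
by rewrite sum_pit ?addn3 // addn2 /side addn3.
Qed.

Lemma phase_step z (s : int) i :
  phase (z + s *: unit_step i) = phase z + s * (2 * i + 1)%N%:Z.
Proof.
rewrite /phase; under eq_bigr do rewrite !mxE mulrDr.
rewrite big_split /=; congr (_ + _); rewrite (bigD1 i) //= big1 ?addr0 => [|j ji].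
  by rewrite !eqxx mulr1 mulrC.
by rewrite (negbTE ji) !mulr0.
Qed.

Lemma sub_step z w i : z = w + unit_step i -> w = z + (-1) *: unit_step i.
Proof. by move=> ->; rewrite scaleN1r addrK. Qed.

(** All weights are odd, so a neighbour of a pit has odd phase. It stays in the
    box because pits avoid the boundary layer. *)
Lemma pits_adjacent K z w : z \in pits K -> face_adjacent z w -> w \in sponge K.
Proof.
move=> /pitsP[zK zp] zw.
have [s [i [s1 ->]]] : exists s i, (s = 1 \/ s = -1) /\ w = z + s *: unit_step i.
  case: zw => i [->|/sub_step ->].
    by exists 1, i; rewrite scale1r; split => //; left.
  by exists (-1), i; split=> //; right.
rewrite !inE; apply/andP; split.
  apply/negP => /andP[_ /andP[_]].
  have /andP[z2 _] := zp; rewrite phase_step /pit_phase => /andP[+ _].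
  by move: z2; case: s1 => ->; lia.
apply/boxP => j; rewrite !mxE; have := zK j.
by case: (j == i) => /=; case: s1 => ->; rewrite ?mulr0 ?mulr1; lia.
Qed.

Lemma spongeP K z : reflect
  ((forall j, 0 <= z ord0 j < (side K + 2)%N%:Z) /\
   ((exists j, z ord0 j = 0 \/ z ord0 j = (side K + 1)%N%:Z) \/
    ~~ pit_phase (phase z)))
  (z \in sponge K).
Proof.
rewrite in_fsetD; apply: (iffP andP) => [[zp /boxP zb]|[zb zp]]; split => //.
- apply: contrapT => /not_orP[zfr /negP/negPn zph]; case/negP: zp.
  apply/pitsP; split => // j; have := zb j.
  have z0 : z ord0 j != 0 by apply/eqP => z0; apply: zfr; exists j; left.
  have z1 : z ord0 j != (side K + 1)%N%:Z.
    by apply/eqP => z1; apply: zfr; exists j; right.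
  by lia.
- apply/pitsP => -[zi zph]; case: zp => [[j zj]|/negP//].
  by have := zi j; lia.
- exact/boxP.
Qed.

Lemma step_minus z (k : nat) i j :
  (z - k%:Z *: unit_step i) ord0 j = z ord0 j - k%:Z * (j == i)%:Z.
Proof. by rewrite !mxE eqxx; case: (j == i). Qed.

(** An even multiple of the odd number [m] is a multiple of [2 * m]. *)
Lemma pit_phase_multiple r : (m %| r)%Z -> ~~ pit_phase r.
Proof.
move=> mr; apply/negP => /andP[r2 /negP]; apply.
rewrite PoszM Gauss_dvdz ?r2 //.
by rewrite coprimezE /= coprime2n; lia.
Qed.

(** The numbers [2 * i + 1], for [i < D], are the odd numbers up to [m], so
    modulo [m] they represent every residue up to sign. The witness removes the
    residue if it is odd, and completes it to [m] if it is even. *)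
Lemma residue_step (r : int) : exists s i,
  (s = 1 \/ s = -1) /\ (m %| r + s * (2 * (i : 'I_D) + 1)%N%:Z)%Z.
Proof.
have m0 : m%:Z != 0 by lia.
have r0 := modz_ge0 r m0.
have rm : (r %% m%:Z)%Z < m%:Z by apply: ltz_pmod; lia.
have rE := divz_eq r m%:Z.
move: (r %/ m%:Z)%Z (r %% m%:Z)%Z r0 rm rE => p t t0 tm ->.
have [k [b tE]] : exists (k : nat) (b : bool), t = k%:Z * 2 + b%:Z.
  by exists (`|t|./2), (odd `|t|); have := odd_double_half `|t|; lia.
case: b tE => tE.
  have kD : (k < D)%N by lia.
  exists (-1), (Ordinal kD); split; first by right.
  by apply/dvdzP; exists p => /=; rewrite tE; lia.
have kD : (d.+1 - k < D)%N by lia.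
exists 1, (Ordinal kD); split; first by left.
by apply/dvdzP; exists (p + 1) => /=; rewrite tE; lia.
Qed.

Section Connectivity.
Context (K : nat) (E : 'rV[int]_D -> 'rV[int]_D -> Prop).
Hypothesis Erefl : forall z, z \in sponge K -> E z z.
Hypothesis Etrans : forall z w u, E z w -> E w u -> E z u.
Hypothesis Estep : forall z w, z \in sponge K -> w \in sponge K ->
  face_adjacent z w -> E z w.

Lemma sponge_line z i (n : nat) :
  (forall k, (k <= n)%N -> z - k%:Z *: unit_step i \in sponge K) ->
  E z (z - n%:Z *: unit_step i).
Proof.
elim: n => [|n IHn] zS.
  by have := zS 0%N (leqnn _); rewrite scale0r subr0; exact: Erefl.
apply: Etrans (IHn _) (Estep (zS _ _) (zS _ _) _) => //.
  by move=> k kn; exact/zS/leqW.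
exists i; right.
by rewrite -[n.+1]addn1 PoszD scalerDl scale1r opprD addrA subrK.
Qed.

Lemma sponge_zero_coord z i :
  (forall k : nat, k%:Z <= z ord0 i -> z - k%:Z *: unit_step i \in sponge K) ->
  0 <= z ord0 i -> E z (zero_coord i z).
Proof.
move=> zS z0; have -> : zero_coord i z = z - `|z ord0 i|%N%:Z *: unit_step i.
  apply/rowP => j; rewrite mxE step_minus gez0_abs //.
  by case: eqP => [->|_]; rewrite ?mulr1 ?subrr ?mulr0 ?subr0.
apply: sponge_line => k kz; apply: zS; rewrite -[leRHS]gez0_abs //.
Qed.

(** A boundary coordinate [j] that is left alone keeps the whole line inside the
    boundary layer of the box, where nothing has been removed. *)
Lemma frame_zero_coord z i j : z \in box (side K + 2) -> i != j ->
  z ord0 j = 0 \/ z ord0 j = (side K + 1)%N%:Z ->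
  zero_coord i z \in box (side K + 2) /\ E z (zero_coord i z).
Proof.
move=> /boxP zb ij zj; split.
  apply/boxP => l; have := zb l; rewrite mxE; case: eqP => //; lia.
apply: sponge_zero_coord => [k kz|]; last by have /andP[] := zb i.
apply/spongeP; split.
  move=> l; rewrite step_minus; have := zb l.
  by case: eqP => [->|_]; rewrite ?mulr1 ?mulr0; lia.
by left; exists j; rewrite step_minus eq_sym (negbTE ij) mulr0 subr0.
Qed.

(** Zero all coordinates except the boundary one, then the boundary coordinate
    itself; the latter is possible since another coordinate is 0 by then. *)
Lemma frame_origin z : z \in box (side K + 2) ->
  (exists j, z ord0 j = 0 \/ z ord0 j = (side K + 1)%N%:Z) -> E z 0.
Proof.
move=> zb [j zj].
pose h (k : nat) : 'rV[int]_D :=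
  \row_i (if ((i < k)%N && (i != j)) then 0 else z ord0 i).
have zh k : h k \in box (side K + 2) /\ E z (h k).
  elim: k => [|k [hb hE]].
    have -> : h 0%N = z by apply/rowP => i; rewrite mxE.
    split => //; apply: Erefl; apply/spongeP; split; last by left; exists j.
    exact/boxP.
  have same : (forall i : 'I_D, i = k :> nat -> i = j) -> h k.+1 = h k.
    move=> kj; apply/rowP => i; rewrite !mxE ltnS leq_eqVlt.
    by have [/eqP/kj ->|//] := boolP (i == k :> nat); rewrite eqxx !andbF.
  have [kD|kD] := ltnP k D; last first.
    rewrite same // => i ik; by have := ltn_ord i; rewrite ik ltnNge kD.
  have [kj|kj] := eqVneq (Ordinal kD) j.
    by rewrite same // => i ik; rewrite -kj; apply/val_inj.
  have hj : h k ord0 j = 0 \/ h k ord0 j = (side K + 1)%N%:Z.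
    by rewrite mxE eqxx andbF.
  have -> : h k.+1 = zero_coord (Ordinal kD) (h k).
    apply/rowP => i; rewrite !mxE ltnS leq_eqVlt -[i == Ordinal kD]val_eqE /=.
    have [/eqP ik|_ //] := boolP (i == k :> nat).
    by rewrite (_ : i = Ordinal kD) ?kj //; apply/val_inj.
  have [] := frame_zero_coord hb kj hj; split => //; exact: Etrans hE _.
have [hb hE] := zh D; apply: Etrans hE _.
have [i ij] : exists i, i != j.
  have [->|] := eqVneq j ord0; first by exists ord_max.
  by rewrite eq_sym; exists ord0.
have hi : h D ord0 i = 0 by rewrite mxE ltn_ord ij.
have ji : j != i by rewrite eq_sym.
have [_] := frame_zero_coord hb ji (or_introl hi).
congr E; apply/rowP => l; rewrite !mxE.
by case: eqP => // /eqP lj; rewrite ltn_ord.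
Qed.

(** Moving along the last axis changes the phase by [m], so a cell whose phase
    is a multiple of [m] lies on a line without pits that reaches the boundary
    of the box. *)
Lemma column_origin z : z \in box (side K + 2) -> (m %| phase z)%Z -> E z 0.
Proof.
move=> zb mz; have /boxP zb' := zb; set i : 'I_D := ord_max.
have E1 : E z (zero_coord i z).
  apply: sponge_zero_coord => [k kz|]; last by have /andP[] := zb' i.
  apply/spongeP; split=> [l|].
    rewrite step_minus; have := zb' l.
    by case: eqP => [->|_]; rewrite ?mulr1 ?mulr0; lia.
  right; rewrite -scaleNr phase_step; apply: pit_phase_multiple.
  by apply: rpredD => //; rewrite (_ : (2 * i + 1)%N = m) ?dvdz_mull //= ; lia.
apply: Etrans E1 _; apply: frame_origin; last first.
  by exists i; left; rewrite mxE eqxx.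
by apply/boxP => l; rewrite mxE; have := zb' l; case: eqP => //; lia.
Qed.

(** One step leads from any interior cell of the sponge to a cell whose phase is
    a multiple of [m]. *)
Lemma sponge_origin z : z \in sponge K -> E z 0.
Proof.
move=> zS; have /spongeP[zb _] := zS; have /boxP zb' := zb.
have [|nfr] := pselect (exists j, z ord0 j = 0 \/ z ord0 j = (side K + 1)%N%:Z).
  exact: frame_origin.
have [s [i [s1 mw]]] := residue_step (phase z).
rewrite -phase_step in mw; set w := z + _ in mw.
have wb : w \in box (side K + 2).
  apply/boxP => j; have := zb j.
  have z0 : z ord0 j != 0 by apply/eqP => z0; apply: nfr; exists j; left.
  have z1 : z ord0 j != (side K + 1)%N%:Z.
    by apply/eqP => z1; apply: nfr; exists j; right.
  rewrite !mxE eqxx /=.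
  by case: (j == i); case: s1 => ->; rewrite ?mulr0 ?mulr1; lia.
apply: Etrans (Estep zS _ _) (column_origin wb mw).
  by apply/spongeP; split; [exact/boxP|right; exact: pit_phase_multiple].
exists i; case: s1 => s1; rewrite /w s1; [left|right].
  by rewrite scale1r.
by rewrite scaleN1r subrK.
Qed.

End Connectivity.

(** A segment of cells that leaves the box at the origin. It adjusts the number
    of tiles without affecting the pits. *)
Definition tail (k : nat) : {fset 'rV[int]_D} :=
  [fset (- j.+1%:Z) *: unit_step ord0 | j in iota 0 k]%fset.

Definition tailed_sponge K k : {fset 'rV[int]_D} := (sponge K `|` tail k)%fset.

Lemma tailP k z : reflect (exists2 j, (j < k)%N & z = (- j.+1%:Z) *: unit_step ord0)
  (z \in tail k).
Proof.
rewrite /tail; apply: (iffP (imfsetP _ _ _ _)) => /= -[j].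
  by rewrite mem_iota add0n => jk ->; exists j.
by move=> jk ->; exists j => //; rewrite mem_iota.
Qed.

Lemma box0_notin_tail N k z : z \in box N -> z \notin tail k.
Proof.
move=> /boxP/(_ ord0) zb; apply/negP => /tailP[j _ zE]; move: zb.
by rewrite zE !mxE !eqxx mulr1; lia.
Qed.

Lemma card_tailed_sponge K k : #|` tailed_sponge K k| =
  ((side K + 2) ^ D - #|` pits K| + k)%N.
Proof.
rewrite cardfsU.
have -> : (sponge K `&` tail k = fset0)%fset.
  apply/eqP; rewrite -fsubset0; apply/fsubsetP => z; rewrite in_fsetI in_fsetD.
  by move=> /andP[/andP[_ /box0_notin_tail/negbTE -> //]].
rewrite cardfs0 subn0; congr addn.
  rewrite cardfsD card_box (fsetIidPr _) //.
  by apply/fsubsetP => z; rewrite !inE => /andP[].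
rewrite card_in_imfset /= ?size_iota //= => [|i j _ _ /rowP/(_ ord0)].
  by rewrite undup_id ?iota_uniq // size_iota.
by rewrite !mxE !eqxx !mulr1 => -[].
Qed.

Section Holes.
Context (R : realType).

Lemma tailed_sponge_connected K k :
  connected (@cells R D [set` tailed_sponge K k])°%classic.
Proof.
pose S := [set` tailed_sponge K k]%classic.
have Sz0 : 0 \in sponge K.
  apply/spongeP; split; first by move=> j; rewrite mxE; lia.
  by left; exists ord0; left; rewrite mxE.
have SS z : z \in sponge K -> S z by move=> zS; rewrite /S /= inE zS.
apply: (@connected_cells _ _ _ 0) => [|z]; first exact: SS.
rewrite /= in_fsetU => /orP[zS|/tailP[j jk ->]].
  apply: connected_component_sym.
  apply: (sponge_origin (E := fun z w => connected_component
    (@cells R D S)°%classic (tile_center z) (tile_center w)) _ _ _ zS).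
  - move=> u /SS uS; apply: connected_component_refl.
    exact/(open_tile_interior uS)/open_tile_tile_center.
  - by move=> u v w; exact: connected_component_trans.
  - move=> u v /SS uS /SS vS; exact: adjacent_component_interior.
elim: j jk => [|j IHj] jk.
  apply: adjacent_component_interior; first exact: SS.
    by rewrite /= in_fsetU; apply/orP; right; apply/tailP; exists 0%N.
  by exists ord0; right; rewrite scaleN1r addNr.
apply: connected_component_trans (IHj (ltnW jk)) _.
apply: adjacent_component_interior.
- by rewrite /= in_fsetU; apply/orP; right; apply/tailP; exists j => //; exact: ltnW.
- by rewrite /= in_fsetU; apply/orP; right; apply/tailP; exists j.+1.
by exists ord0; right; rewrite -[X in _ + X]scale1r -scalerDl; congr (_ *: _); lia.
Qed.

Lemma tailed_sponge_holes K k :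
  (`I_#|` pits K| #<= holes (@cells R D [set` tailed_sponge K k]))%card.
Proof.
pose S := [set` tailed_sponge K k]%classic.
pose F z := connected_component (~` @cells R D S)%classic (tile_center z).
have padj z : z \in pits K -> forall w, face_adjacent z w -> S w.
  by move=> zp w /(pits_adjacent zp) wS; rewrite /S /= in_fsetU wS.
have pnS z : z \in pits K -> ~ S z.
  move=> zp; rewrite /S /= in_fsetU in_fsetD zp /= => zt.
  have zb : z \in box (side K + 2) by move: zp; rewrite !inE => /andP[].
  by move: (box0_notin_tail k zb); rewrite zt.
have Finj : {in [set` pits K]%classic &, injective F}.
  move=> z w /set_mem zp /set_mem wp; apply: isolated_hole_inj; try exact: pnS.
  exact: padj.
have : ([set` pits K] #= `I_#|` pits K|)%card by exact/card_eq_fsetP.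
rewrite card_eq_le => /andP[_ le1]; apply: card_le_trans le1 _.
move: (inj_card_eq Finj); rewrite card_eq_le => /andP[_ le2].
apply: card_le_trans le2 (subset_card_le _) => _ [z /= zp <-].
exact: isolated_hole (pnS _ zp) (padj _ zp).
Qed.

End Holes.

End Construction.

(** * The maximal number of holes *)

Lemma omino_fset (R : realType) d n (P : set 'rV[R]_d) : omino n P ->
  exists S : {fset 'rV[int]_d}, [/\ #|` S| = n, P = @cells R d [set` S]%classic &
    connected P°%classic].
Proof.
move=> [S [Sn PE Pc]]; exists (fset_set S); split=> //.
  exact: card_fset_set.
by rewrite fset_setK //; apply/finite_setP; exists n.
Qed.

Lemma omino_holes_count (R : realType) d n (P : set 'rV[R]_d) :
  (0 < d)%N -> (0 < n)%N -> omino n P ->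
  exists h p : nat, [/\ (holes P #= `I_h)%card, (n ^ d.-1 <= p ^ d)%N &
    (n + p + d * h <= (d * n).+1)%N].
Proof.
move=> d0 n0 /omino_fset[S [Sn PE Pc]].
have S0 : S != fset0 by rewrite -cardfs_gt0 Sn.
rewrite PE in Pc *; have [h hE hle] := holes_count d0 S0 Pc.
exists h, (\sum_(i < d) #|` shadow i S|)%N; rewrite -Sn; split => //.
exact: card_le_sum_shadows.
Qed.

(** The number of holes of an n-omino is at most n, so a maximum exists as soon
    as there is an n-omino. *)
Lemma max_holesP (R : realType) d n : (0 < d)%N -> (0 < n)%N ->
  (exists P : set 'rV[R]_d, omino n P) ->
  is_max_holes R d n (max_holes R d n).
Proof.
move=> d0 n0 [P0 oP0].
pose Q h := `[< exists2 P : set 'rV[R]_d, omino n P & (holes P #= `I_h)%card >].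
have Qex : exists h, Q h.
  have [h [p [hE _ _]]] := omino_holes_count d0 n0 oP0.
  by exists h; apply/asboolP; exists P0.
have Qle h : Q h -> (h <= n)%N.
  move=> /asboolP[P oP hP]; have [h' [p [hE np hle]]] := omino_holes_count d0 n0 oP.
  have -> : h = h'.
    by apply/card_eq_II; rewrite (card_eq_trans _ hE) // card_eq_sym.
  have p0 : (0 < p)%N.
    rewrite lt0n; apply/eqP => p0; move: np; rewrite p0 exp0n //.
    by rewrite leqn0 expn_eq0 -leqn0 leqNgt n0.
  by rewrite -(leq_pmul2l d0); lia.
have [h /asboolP[P oP hP] hmax] := ex_maxnP Qex Qle.
rewrite /max_holes; case: xgetP => [m -> //|/(_ h) []].
split; first by exists P.
move=> P' oP'; have [h' [p [hE _ _]]] := omino_holes_count d0 n0 oP'.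
have hh : (h' <= h)%N by apply: hmax; apply/asboolP; exists P'.
rewrite -card_le_II in hh; apply: card_le_trans hh.
by move: hE; rewrite card_eq_le => /andP[].
Qed.

Lemma expn_increment (a e k : nat) :
  ((a + e) ^ k.+1 <= a ^ k.+1 + k.+1 * e * (a + e) ^ k)%N.
Proof.
elim: k => [|k IHk]; first by rewrite !expn1 expn0; lia.
have ae : (a ^ k.+1 <= (a + e) ^ k.+1)%N by rewrite leq_exp2r // leq_addr.
rewrite expnS (leq_trans (leq_mul (leqnn _) IHk)) //.
rewrite [(a ^ k.+2)%N]expnS; have := leq_mul (leqnn e) ae.
rewrite [((a + e) ^ k.+1)%N]expnS.
by move: (a ^ k.+1)%N ((a + e) ^ k)%N => x y; nia.
Qed.

Section LowerBound.
Context (R : realType) (d : nat).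
Local Notation D := d.+2.
Local Notation m := (2 * d + 3)%N.

Lemma pits_density K : (m * #|` @pits d K| = d.+1 * side (d := d) K ^ D)%N.
Proof.
rewrite card_pits [(side K ^ D)%N]expnS.
by move: (side K ^ d.+1)%N => y; rewrite /side; lia.
Qed.

Lemma double_pits_le K : (2 * #|` @pits d K| <= @side d K ^ D)%N.
Proof.
have := pits_density K; move: #|` _| (_ ^ D)%N => h x E.
by rewrite -(@leq_pmul2l m) ?addn3 // -addn3; nia.
Qed.

Definition sponge_size K : nat := ((@side d K + 2) ^ D - #|` @pits d K|)%N.

Lemma sponge_size_ge K : ((@side d K + 2) ^ D <= 2 * sponge_size K)%N.
Proof.
have := double_pits_le K; rewrite /sponge_size.
have : (@side d K ^ D <= (@side d K + 2) ^ D)%N by rewrite leq_exp2r // leq_addr.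
by lia.
Qed.

Lemma tailed_sponge_omino K k :
  omino (sponge_size K + k) (@cells R D [set` tailed_sponge K k]%classic).
Proof.
exists [set` tailed_sponge K k]%classic; split=> //.
  by apply/card_eq_fsetP; rewrite card_tailed_sponge.
exact: tailed_sponge_connected.
Qed.

(** Take the largest sponge with at most [n] tiles and complete it by a tail.
    The loss comes from the boundary layer of the box and from the tail; the
    tail is shorter than the difference of two consecutive sponges. Together
    they are bounded by the growth of a power between the interior side [M] of
    the sponge and the side [X] of the next box. *)
Lemma max_holes_ge n : (2 ^ D <= n)%N -> exists X : nat,
  (X ^ D <= 2 * (m + 1) ^ D * n)%N /\
  (d.+1 * n <= D * max_holes R D n + d.+1 * (D * (2 * m + 2) * X ^ d.+1))%N.
Proof.
move=> n2; pose p K := (sponge_size K <= n)%N.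
have p0 : p 0%N by rewrite /p /sponge_size /side muln0 add0n (leq_trans (leq_subr _ _)).
have pK K : p K -> (K <= n)%N.
  rewrite /p => le; have := sponge_size_ge K.
  have : ((@side d K + 2) ^ 1 <= (@side d K + 2) ^ D)%N by rewrite leq_exp2l ?addn2.
  by rewrite expn1 {1}/side; move: (_ ^ D)%N => y; nia.
have [K Kn Kmax] := ex_maxnP (ex_intro _ 0%N p0) pK.
have nK : (n < sponge_size K.+1)%N.
  by rewrite ltnNge; apply/negP => /Kmax; rewrite ltnn.
have om : omino n (@cells R D [set` tailed_sponge K (n - sponge_size K)]%classic).
  by have := tailed_sponge_omino K (n - sponge_size K); rewrite subnKC.
have n0 : (0 < n)%N by apply: leq_trans n2; rewrite expn_gt0.
have [_ /(_ _ om) hle] := @max_holesP R D n isT n0 (ex_intro _ _ om).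
have fge : (#|` @pits d K| <= max_holes R D n)%N.
  by rewrite -card_le_II; exact: card_le_trans (tailed_sponge_holes _ _ _) hle.
pose M := @side d K.
have sideS : @side d K.+1 = (M + 2 * m)%N by rewrite /M /side mulnS addnC.
(* The side of the next box. *)
exists (M + (2 * m + 2))%N; split.
  have h1 : ((M + (2 * m + 2)) ^ D <= ((m + 1) * (M + 2)) ^ D)%N.
    by rewrite leq_exp2r // mulnDl mul1n !mulnDr; lia.
  apply: leq_trans h1 _; rewrite expnMn.
  have := sponge_size_ge K; rewrite -/M; move: Kn; rewrite /p.
  by move: (_ ^ D)%N (_ ^ D)%N => x y; nia.
have inc := expn_increment M (2 * m + 2) d.+1.
have dens := pits_density K; rewrite -/M in dens.
have densS := pits_density K.+1; rewrite sideS in densS.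
have mono : (M ^ D <= (M + 2 * m) ^ D)%N by rewrite leq_exp2r // leq_addr.
have szS : (sponge_size K.+1 + #|` @pits d K.+1| = (M + (2 * m + 2)) ^ D)%N.
  rewrite (addnA M) /sponge_size sideS subnK //.
  have : ((M + 2 * m) ^ D <= (M + 2 * m + 2) ^ D)%N by rewrite leq_exp2r // leq_addr.
  by have := double_pits_le K.+1; rewrite sideS; lia.
have incm : (#|` @pits d K| <= #|` @pits d K.+1|)%N.
  rewrite -(@leq_pmul2l m) ?addn3 // -addn3 dens densS.
  by rewrite leq_mul2l mono orbT.
move: inc dens szS nK incm fge {densS mono Kmax pK p0 p Kn n2 sideS hle om}.
move: (max_holes R D n) (sponge_size K.+1) #|` @pits d K| #|` @pits d K.+1|.
move: (M ^ D)%N ((M + (2 * m + 2)) ^ D)%N => x y f s h h'.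
move: (_ ^ d.+1)%N => z; nia.
Qed.
End LowerBound.

Lemma max_holes_le (R : realType) d n : (0 < d)%N -> (0 < n)%N ->
  (exists P : set 'rV[R]_d, omino n P) ->
  exists2 p, (n ^ d.-1 <= p ^ d)%N &
    (n + p + d * max_holes R d n <= (d * n).+1)%N.
Proof.
move=> d0 n0 om; have [[P oP hP] _] := max_holesP d0 n0 om.
have [h [p [hE np hle]]] := omino_holes_count d0 n0 oP.
exists p => //; suff -> : max_holes R d n = h by [].
by apply/card_eq_II; rewrite (card_eq_trans _ hE) // card_eq_sym.
Qed.

(** * Real exponents and the asymptotic estimate *)

Section PowR.
Context (R : realType) (k : nat).
Local Notation alpha := (k%:R / k.+1%:R : R).

Lemma powR_nat_expn (X : nat) : (X ^ k)%:R = (X ^ k.+1)%:R `^ alpha :> R.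
Proof.
by rewrite !natrX -!powR_mulrn // -powRrM mulrCA divff ?mulr1 ?pnatr_eq0.
Qed.

Lemma powR_le_of_expn (n p : nat) : (n ^ k <= p ^ k.+1)%N -> n%:R `^ alpha <= p%:R :> R.
Proof.
move=> np; rewrite powRrM powR_mulrn // -natrX.
have -> : p%:R = (p ^ k.+1)%:R `^ (k.+1%:R)^-1 :> R.
  by rewrite natrX -powR_mulrn // -powRrM divff ?powRr1 // pnatr_eq0.
by rewrite ge0_ler_powR ?nnegrE ?invr_ge0 // ler_nat.
Qed.

Lemma expn_le_powR (X C n : nat) : (0 < C)%N -> (X ^ k.+1 <= C * n)%N ->
  (X ^ k)%:R <= C%:R * n%:R `^ alpha :> R.
Proof.
move=> C0 XC; rewrite powR_nat_expn.
have a0 : 0 <= alpha by rewrite divr_ge0.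
have a1 : alpha <= 1 by rewrite ler_pdivrMr ?mul1r ?ler_nat // ltr0n.
apply: (@le_trans _ _ ((C * n)%:R `^ alpha)).
  by rewrite ge0_ler_powR ?nnegrE // ler_nat.
rewrite natrM powRM // ler_wpM2r ?powR_ge0 //.
by rewrite -[leRHS]powRr1 // ler_powR // ler1n.
Qed.
End PowR.

Theorem theorem1p1 (R : realType) (d : nat) (hd : (2 <= d)%N) :
  exists c1 c2 : R, exists n0 : nat,
    [/\ 0 < c1, 0 < c2 &
      forall n : nat, (n0 <= n)%N ->
        c1 * n%:R `^ ((d%:R - 1) / d%:R)
          <= (d%:R - 1) / d%:R * n%:R - (max_holes R d n)%:R
          <= c2 * n%:R `^ ((d%:R - 1) / d%:R)].
Proof.
case: d hd => [|[|d]] // _.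
pose m := (2 * d + 3)%N.
have [C C0 CE] : exists2 C, (0 < C)%N & C = (2 * (m + 1) ^ d.+2)%N.
  by eexists; last by []; rewrite muln_gt0 expn_gt0 addn1.
(* [2 ^ d.+2] is the number of tiles of the smallest box, which has no pits; it
   is also large enough to force [p >= 2], hence [p - 1 >= p / 2], below. *)
exists (2 * d.+2%:R)^-1, (d.+1 * (2 * m + 2) * C)%:R, (2 ^ d.+2)%N; split.
- by rewrite invr_gt0 mulr_gt0 ?ltr0n.
- by rewrite ltr0n (muln_gt0 _ C) C0 andbT muln_gt0 addn2.
move=> n n2; have n0 : (0 < n)%N by apply: leq_trans n2; rewrite expn_gt0.
have om : exists P : set 'rV[R]_d.+2, omino n P.
  exists (@cells R d.+2 [set` tailed_sponge 0 (n - 2 ^ d.+2)]%classic).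
  have := tailed_sponge_omino R d 0 (n - 2 ^ d.+2).
  rewrite /sponge_size card_pits /side !muln0 mul0n add0n subn0.
  by rewrite subnKC.
have D1 : d.+2%:R - 1 = d.+1%:R :> R by rewrite -[d.+2%:R]natr1 addrK.
have D0 : 0 < d.+2%:R :> R by rewrite ltr0n.
rewrite D1; set a := n%:R `^ _; set f := max_holes _ _ _.
have -> : d.+1%:R / d.+2%:R * n%:R - f%:R =
    (d.+1%:R * n%:R - d.+2%:R * f%:R) / d.+2%:R :> R.
  by rewrite mulrBl mulrAC [_ * f%:R]mulrC mulfK // gt_eqF.
apply/andP; split.
  have [p np] := max_holes_le (ltn0Sn _) n0 om; rewrite -/f => fle.
  have ap : a <= p%:R by exact: powR_le_of_expn.
  have p2 : (2 <= p)%N.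
    rewrite leqNgt; apply/negP => p1.
    have : (n ^ d.+1 <= 1)%N.
      by apply: leq_trans np _; rewrite -(exp1n d.+2) leq_exp2r.
    apply/negP; rewrite -ltnNge; apply: (@leq_trans (2 ^ d.+2)).
      by rewrite -[1%N](expn0 2) ltn_exp2l.
    by apply: leq_trans n2 _; rewrite -{1}[n]expn1 leq_pexp2l.
  rewrite invfM mulrAC ler_pM2r ?invr_gt0 // mulrC.
  have : (n + p + d.+2 * f)%:R <= (d.+2 * n).+1%:R :> R by rewrite ler_nat.
  rewrite -natr1 !natrD !natrM -D1.
  have : 2 <= p%:R :> R by rewrite ler_nat.
  by lra.
have [X [+ +]] := max_holes_ge R n2; rewrite -/f -/m -CE => XC fge.
have Xa : (X ^ d.+1)%:R <= C%:R * a by exact: expn_le_powR.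
rewrite ler_pdivrMr //.
have : (d.+1 * n)%:R <= (d.+2 * f + d.+1 * (d.+2 * (2 * m + 2) * X ^ d.+1))%:R :> R.
  by rewrite ler_nat.
rewrite natrD !natrM => fge'; rewrite lerBlDl (le_trans fge') // lerD2l.
have -> : d.+1%:R * (2 * m + 2)%:R * C%:R * a * d.+2%:R =
    d.+1%:R * (d.+2%:R * (2 * m + 2)%:R * (C%:R * a)) :> R by ring.
by rewrite ler_wpM2l // ler_wpM2l // mulr_ge0.
Qed.
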